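(* Let $f$, $\varphi$, $\psi=f+\varphi$, $\tau>0$, $\bar x$, $\bar v=-\nabla f(\bar x)$, $\bar z=\bar x+\tau\bar v$ be as in the context. Assume that: (1) $\varphi$ is globally prox-regular at $\bar x$ for $\bar v$ with constant $\rho$, and $\tau\rho<1$; (2) $\varphi$ is twice epi-differentiable at $\bar x$ for $\bar v$ and $\mathrm{d}^2\varphi(\bar x|\bar v)(h)=\langle h,Qh\rangle+\iota_S(h)$ for all $h\in\mathbb{R}^n$, where $S\subseteq\mathbb{R}^n$ is a closed convex cone and $Q\in\mathbb{R}^{n\times n}$ is symmetric with $\mathcal{R}(Q)\subseteq\mathrm{aff}(S)$; (3) $\Pi_{\mathrm{aff}(S)}(I+\tau Q)^{-1}\Pi_{\mathrm{aff}(S)}\in\partial\mathrm{prox}_{\tau\varphi}(\bar z)$. If there is $\sigma>0$ such that $$D\nabla^2 f(\bar x)D+\tau^{-1}D(I-D)\succeq\sigma D^2\quad\forall\,D\in\partial\mathrm{prox}_{\tau\varphi}(\bar z),$$ then there is $\sigma>0$ such that $$\langle h,[\nabla^2 f(\bar x)+Q]h\rangle\ge\sigma\|h\|^2\quad\forall\,h\in\mathrm{aff}(S).$$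
   Context: Setting: $f:\mathbb{R}^n\to\mathbb{R}$ is twice continuously differentiable, $\varphi:\mathbb{R}^n\to(-\infty,\infty]$ is proper, lower semicontinuous (lsc) and prox-bounded, $\psi=f+\varphi$, $\tau>0$, and $\bar x$ satisfies $0\in\partial\psi(\bar x)$. Here $\partial$ (for extended real-valued functions) is the limiting subdifferential: $\hat\partial\theta(x)=\{v:\theta(y)\ge\theta(x)+\langle v,y-x\rangle+o(\|y-x\|)\}$ and $\partial\theta(x)=\limsup_{y\to x,\,\theta(y)\to\theta(x)}\hat\partial\theta(y)$. Global prox-regularity: $\varphi$ is globally prox-regular at $\bar x$ for $\bar v\in\partial\varphi(\bar x)$ with constant $\rho$ if $\varphi$ is locally lsc at $\bar x$ and there is $\epsilon>0$ such that $\varphi(x')\ge\varphi(x)+\langle v,x'-x\rangle-\frac{\rho}{2}\|x'-x\|^2$ for all $x'\in\mathbb{R}^n$ whenever $\|x-\bar x\|<\epsilon$, $\|v-\bar v\|<\epsilon$, $v\in\partial\varphi(x)$, $\varphi(x)<\varphi(\bar x)+\epsilon$. Proximity operator: $\mathrm{prox}_{\tau\varphi}(x)\in\mathrm{argmin}_{y}\,\varphi(y)+\frac{1}{2\tau}\|x-y\|^2$; under (1) it is single-valued and Lipschitz continuous near $\bar z$. For a locally Lipschitz map $G$, $\partial_BG(x)$ is the set of limits of Jacobians $\mathcal{D}G(x^k)$ with $x^k\to x$ and $G$ differentiable at $x^k$, and $\partial G(x)=\mathrm{conv}(\partial_BG(x))$ is Clarke's generalized Jacobian. Under (1) and (2)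 the matrix $I+\tau Q$ is positive definite. Second subderivative: $\mathrm{d}^2\theta(x|\alpha)(h)=\liminf_{t\downarrow0,\,\tilde h\to h}\Delta_t^2\theta(x|\alpha)(\tilde h)$ with $\Delta_t^2\theta(x|\alpha)(h)=\frac{\theta(x+th)-\theta(x)-t\langle\alpha,h\rangle}{\frac12t^2}$; $\theta$ is twice epi-differentiable at $x$ for $\alpha$ if the functions $\Delta_t^2\theta(x|\alpha)$ epi-converge as $t\downarrow0$. Notation: $\iota_S$ is the indicator function, $\mathrm{aff}(S)$ the affine hull, $\mathcal{R}(\cdot)$ the range of a matrix, $\Pi_L$ the orthogonal projection matrix onto a subspace $L$, and $A\succeq B$ means $A-B$ is positive semidefinite. *)

(* Defs.v *)
From HB Require Import structures.
From mathcomp Require Export all_boot all_order all_algebra.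
From mathcomp Require Export all_classical all_reals all_analysis.

Set Implicit Arguments.
Unset Strict Implicit.
Unset Printing Implicit Defensive.

Export Order.TTheory GRing.Theory Num.Theory.
Export numFieldNormedType.Exports.

Local Open Scope classical_set_scope.
Local Open Scope ring_scope.

(* Vectors of R^n are columns 'cV[R]_n.  The library norm `|x| on matrices is
   the sup norm (it induces the usual topology), hence the Euclidean norm. *)

Definition dot (R : realType) (n : nat) (u v : 'cV[R]_n) : R :=
  \sum_(i < n) u i 0 * v i 0.

Definition norm2 (R : realType) (n : nat) (u : 'cV[R]_n) : R :=
  Num.sqrt (dot u u).

(* No symmetry is required of A. *)
Definition psd (R : realType) (n : nat) (A : 'M[R]_n) : Prop :=
  forall h : 'cV[R]_n, 0 <= dot h (A *m h).

Definition loewner_ge (R : realType) (n : nat) (A B : 'M[R]_n) : Prop :=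
  psd (A - B).

Definition jac (R : realType) (m n : nat) (G : 'cV[R]_n -> 'cV[R]_m)
    (x : 'cV[R]_n) : 'M[R]_(m, n) :=
  \matrix_(i < m, j < n) ('D_(delta_mx j 0) G x) i 0.

Definition grad (R : realType) (n : nat) (f : 'cV[R]_n -> R) (x : 'cV[R]_n) :
    'cV[R]_n :=
  \col_(i < n) 'D_(delta_mx i 0) (f : 'cV[R]_n -> R^o) x.

Definition hess (R : realType) (n : nat) (f : 'cV[R]_n -> R) (x : 'cV[R]_n) :
    'M[R]_n :=
  jac (grad f) x.

Definition twice_cont_differentiable (R : realType) (n : nat)
    (f : 'cV[R]_n -> R) : Prop :=
  [/\ forall x, differentiable (f : 'cV[R]_n -> R^o) x,
      forall x, differentiable (grad f) x &
      continuous (hess f)].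

Section ConvexGeometry.
Variables (R : realType) (E : lmodType R).
Implicit Type S : set E.

Definition cone S : Prop :=
  S 0 /\ forall (a : R) x, 0 < a -> S x -> S (a *: x).

Definition aff S : set E :=
  [set x | exists (m : nat) (c : 'I_m -> R) (p : 'I_m -> E),
    [/\ forall i, S (p i), \sum_(i < m) c i = 1 &
        x = \sum_(i < m) c i *: p i]].

Definition conv_hull S : set E :=
  [set x | exists (m : nat) (c : 'I_m -> R) (p : 'I_m -> E),
    [/\ forall i, S (p i), forall i, 0 <= c i, \sum_(i < m) c i = 1 &
        x = \sum_(i < m) c i *: p i]].

Definition indicator S (x : E) : \bar R := if `[< S x >] then 0%E else +oo%E.

End ConvexGeometry.

Definition is_orthproj (R : realType) (n : nat) (L : set 'cV[R]_n)
    (P : 'M[R]_n) : Prop :=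
  forall x : 'cV[R]_n, L (P *m x) /\ forall y, L y -> dot (x - P *m x) y = 0.

(* For a linear subspace L there is exactly one such P. *)
Definition orthproj (R : realType) (n : nat) (L : set 'cV[R]_n) : 'M[R]_n :=
  xget 0 [set P | is_orthproj L P].

Section Variational.
Variables (R : realType) (n : nat).
Local Notation V := 'cV[R]_n.
Implicit Type theta : V -> \bar R.

Local Open Scope ereal_scope.

Definition proper theta : Prop :=
  (forall x, -oo < theta x) /\ exists x, theta x < +oo.

Definition prox_objective (tau : R) theta (x y : V) : \bar R :=
  theta y + ((2 * tau)^-1 * norm2 (x - y) ^+ 2)%:E.

(* Finiteness of the Moreau envelope at some point for some parameter. *)
Definition prox_bounded theta : Prop :=
  exists lambda : R, (0 < lambda)%R /\
    exists x, -oo < ereal_inf (range (prox_objective lambda theta x)).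

(* Empty outside the effective domain, by convention. *)
Definition regular_subdiff theta (x : V) : set V :=
  [set v | theta x \is a fin_num /\
    forall e : R, (0 < e)%R -> \forall y \near x,
      theta x + (dot v (y - x) - e * norm2 (y - x))%:E <= theta y].

Definition limiting_subdiff theta (x : V) : set V :=
  [set v | theta x \is a fin_num /\
    exists (y w : V^nat),
      [/\ forall k, regular_subdiff theta (y k) (w k),
          y @ \oo --> x, theta \o y @ \oo --> theta x & w @ \oo --> v]].

(* Rockafellar-Wets, Variational Analysis, Definition 1.33. *)
Definition locally_lsc theta (x : V) : Prop :=
  exists2 e : R, (0 < e)%R &
    forall a : R, a%:E <= theta x + e%:E ->
      closed [set y | (norm2 (y - x) <= e)%R /\ theta y <= a%:E].

Definition globally_prox_regular theta (xb vb : V) (rho : R) : Prop :=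
  [/\ limiting_subdiff theta xb vb,
      locally_lsc theta xb &
      exists2 e : R, (0 < e)%R &
        forall x v : V,
          (norm2 (x - xb) < e)%R -> (norm2 (v - vb) < e)%R ->
          limiting_subdiff theta x v -> theta x < theta xb + e%:E ->
          forall x' : V,
            theta x + (dot v (x' - x) - rho / 2 * norm2 (x' - x) ^+ 2)%:E
              <= theta x'].

Definition prox_argmin (tau : R) theta (x : V) : set V :=
  [set y | forall y',
     prox_objective tau theta x y <= prox_objective tau theta x y'].

(* A selection of the argmin. *)
Definition prox (tau : R) theta (x : V) : V := xget 0%R (prox_argmin tau theta x).

Definition diff_quot2 theta (x a : V) (t : R) (h : V) : \bar R :=
  (theta (x + t *: h)%R - theta x - (t * dot a h)%:E) * ((2^-1 * t ^+ 2)^-1)%:E.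

Definition second_subderivative theta (x a h : V) : \bar R :=
  limf_einf (fun p : R * V => diff_quot2 theta x a p.1 p.2)
            (filter_prod 0^'+ (nbhs h)).

(* Epi-convergence of F t to g as t decreases to 0, along every sequence of
   parameters; Rockafellar-Wets, Variational Analysis, Proposition 7.2. *)
Definition epi_converges_at_0 (F : R -> V -> \bar R) (g : V -> \bar R) : Prop :=
  forall t : R^nat, (forall k, 0 < t k)%R -> t @ \oo --> (0 : R)%R ->
  forall h : V,
    (forall u : V^nat, u @ \oo --> h ->
       g h <= limn_einf (fun k => F (t k) (u k))) /\
    (exists2 u : V^nat, u @ \oo --> h &
       limn_esup (fun k => F (t k) (u k)) <= g h).

Definition twice_epi_differentiable theta (x a : V) : Prop :=
  exists g, epi_converges_at_0 (diff_quot2 theta x a) g.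

End Variational.

Definition bouligand_jacobian (R : realType) (m n : nat)
    (G : 'cV[R]_n -> 'cV[R]_m) (x : 'cV[R]_n) : set 'M[R]_(m, n) :=
  [set A | exists y : ('cV[R]_n)^nat,
    [/\ y @ \oo --> x, forall k, differentiable G (y k) &
        jac G \o y @ \oo --> A]].

Definition clarke_jacobian (R : realType) (m n : nat)
    (G : 'cV[R]_n -> 'cV[R]_m) (x : 'cV[R]_n) : set 'M[R]_(m, n) :=
  conv_hull (bouligand_jacobian G x).

(* Main.v *)
Require Import Defs.
From mathcomp Require Import ring lra.

(** Write [M = I + tau Q], [L = aff S] and [P] for the orthogonal projection
    onto [L]. If [M] is invertible, the theorem is a computation: the matrix
    [D = P M^-1 P] belongs to the generalized Jacobian of the proximal map, it is
    symmetric, and for [h] in [L] the vector [M h] lies in [L], so that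
    [D (M h) = h]. Evaluating the growth hypothesis for [D] at [M h], the three
    terms become [<h, hess f h>], [tau^-1 <h, M h - h> = <h, Q h>] and
    [sigma |h|^2], which is the conclusion with the same [sigma].

    The substance is therefore the invertibility of [M]. A vector [k] in its
    kernel equals [- tau Q k], hence lies in [L], and [L = S - S] because [S] is a
    convex cone. So it is enough that [<k, Q k> >= - rho |k|^2] on [S - S]: together
    with [tau rho < 1] this forces [k = 0]. On [S] itself the bound is immediate
    from prox-regularity; on differences of elements of [S] it expresses that the
    second subderivative plus [rho |.|^2] is midpoint convex
    (lemma [second_subderivative_mid]), a property which has to be inherited from
    the hypomonotonicity of the subgradients of [phi] near [xb].

    For that, take recovery sequences [x_k -> x] and [u_k -> u] of the
    second-order quotients for a step [t = lam^2] with [lam -> 0], and apply the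
    proximal map with the small parameter [lam] to the point
    [xb + lam vb + t mid x_k u_k]. The result is a point [xb + t h_k] with the
    proximal subgradient [vb + lam (mid x_k u_k - h_k)]. Both are close to
    [(xb, vb)], so the prox-regularity inequality holds there; testing it at
    [xb + t x_k] and [xb + t u_k] and averaging shows at once that
    [h_k - mid x_k u_k -> 0] and that the quotient at [h_k] is at most
    [(a + b) / 2 + rho / 4 |x_k - u_k|^2] (lemma [midpoint_proximal_bound]). Here
    [a] and [b] bound the quotients at [x_k] and [u_k]. The second subderivative
    at [mid x u] is a lower limit of such quotients, whence the claim. *)

Set Implicit Arguments.
Unset Strict Implicit.
Unset Printing Implicit Defensive.

Local Open Scope classical_set_scope.
Local Open Scope ring_scope.

(** * Euclidean geometry of column vectors *)

Section EuclideanSpace.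
Variables (R : realType) (n : nat).
Implicit Types (u v w : 'cV[R]_n) (a e : R).

Lemma dotE u v : dot u v = (u^T *m v) 0 0.
Proof. by rewrite mxE /dot; apply: eq_bigr => i _; rewrite mxE. Qed.

Lemma dotC u v : dot u v = dot v u.
Proof. by rewrite /dot; apply: eq_bigr => i _; rewrite mulrC. Qed.

Lemma dotDl u v w : dot (u + v) w = dot u w + dot v w.
Proof. by rewrite !dotE linearD mulmxDl mxE. Qed.

Lemma dotZl a u w : dot (a *: u) w = a * dot u w.
Proof. by rewrite !dotE linearZ -scalemxAl mxE. Qed.

Lemma dotNl u w : dot (- u) w = - dot u w.
Proof. by rewrite -scaleN1r dotZl mulN1r. Qed.

Lemma dotDr u v w : dot w (u + v) = dot w u + dot w v.
Proof. by rewrite dotC dotDl !(dotC w). Qed.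

Lemma dotZr a u w : dot w (a *: u) = a * dot w u.
Proof. by rewrite dotC dotZl dotC. Qed.

Lemma dotNr u w : dot w (- u) = - dot w u.
Proof. by rewrite dotC dotNl dotC. Qed.

Definition dot_linear := (dotDl, dotDr, dotNl, dotNr, dotZl, dotZr).

Lemma dot0l u : dot 0 u = 0.
Proof. by rewrite -(scale0r 0) dotZl mul0r. Qed.

Lemma dot_mulmxr (A : 'M[R]_n) u v : dot u (A *m v) = dot (A^T *m u) v.
Proof. by rewrite !dotE trmx_mul trmxK mulmxA. Qed.

Lemma dot_ge0 u : 0 <= dot u u.
Proof. by apply: sumr_ge0 => i _; rewrite -expr2 sqr_ge0. Qed.

Lemma dot_eq0 u : dot u u = 0 -> u = 0.
Proof.
move=> /eqP; rewrite psumr_eq0 => [/allP u0|i _]; last by rewrite -expr2 sqr_ge0.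
apply/colP => i; rewrite mxE.
by have := u0 i (mem_index_enum _); rewrite -expr2 sqrf_eq0 => /eqP.
Qed.

Lemma norm2_sq u : norm2 u ^+ 2 = dot u u.
Proof. by rewrite sqr_sqrtr // dot_ge0. Qed.

Lemma norm2_ge0 u : 0 <= norm2 u.
Proof. exact: sqrtr_ge0. Qed.

Lemma norm2_lt u e : 0 < e -> (norm2 u < e) = (dot u u < e ^+ 2).
Proof.
by move=> e0; rewrite -norm2_sq ltr_sqr ?nnegrE ?norm2_ge0 // ltW.
Qed.

Lemma sqr_coord_le u i : u i 0 ^+ 2 <= dot u u.
Proof.
rewrite /dot (bigD1 i) //= -expr2 lerDl sumr_ge0 // => j _.
by rewrite -expr2 sqr_ge0.
Qed.

Lemma coord_le_norm2 u i : `|u i 0| <= norm2 u.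
Proof.
rewrite -ler_sqr ?nnegrE ?norm2_ge0 ?normr_ge0 //.
by rewrite norm2_sq real_normK ?num_real ?sqr_coord_le.
Qed.

(** The factor [n.+1] instead of [sqrt n] is crude, but makes sense for [n = 0]. *)
Lemma norm2_lt_coord u e : 0 < e -> (forall i, `|u i 0| < e / n.+1%:R) ->
  norm2 u < e.
Proof.
move=> e0 ue; rewrite norm2_lt //.
have d0 : 0 < e / n.+1%:R by rewrite divr_gt0 // ltr0n.
have : dot u u <= \sum_(i < n) (e / n.+1%:R) ^+ 2.
  apply: ler_sum => i _; rewrite -expr2 -[leLHS]real_normK ?num_real //.
  by rewrite ler_sqr ?nnegrE ?normr_ge0 ?(ltW d0) ?(ltW (ue i)).
move=> /le_lt_trans; apply.
rewrite sumr_const card_ord -[ltLHS]mulr_natr exprMn exprVn -mulrA.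
rewrite gtr_pMr ?exprn_gt0 // mulrC ltr_pdivrMr ?exprn_gt0 ?ltr0n // mul1r.
by rewrite -natrX ltr_nat (leq_trans (ltnSn n)) // leq_pmulr.
Qed.

(** The topology of matrices comes from the sup norm, which the Euclidean norm
    dominates and which dominates it up to a factor depending on [n]. *)
Lemma nbhs_norm2P u (P : set 'cV[R]_n) :
  nbhs u P <-> exists2 e, 0 < e & forall v, norm2 (v - u) < e -> P v.
Proof.
split=> [/nbhs_ballP[e /= e0 eP]|[e e0 eP]].
  exists e => // v uv; apply: eP; split=> // i j.
  rewrite -ball_normE /= (ord1 j).
  have := coord_le_norm2 (v - u) i; rewrite !mxE distrC => /le_lt_trans; exact.
apply/nbhs_ballP; exists (e / n.+1%:R); first by rewrite /= divr_gt0 ?ltr0n.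
move=> v [_ uv]; apply: eP; apply: norm2_lt_coord => // i.
by have := uv i 0; rewrite -ball_normE /= !mxE distrC.
Qed.

Lemma cvg_norm2 (x : ('cV[R]_n)^nat) u : x @ \oo --> u ->
  forall e, 0 < e -> \forall k \near \oo, norm2 (x k - u) < e.
Proof.
move=> xu e e0; apply: (xu [set v | norm2 (v - u) < e]).
by apply/nbhs_norm2P; exists e.
Qed.

End EuclideanSpace.

(** * Minimization of lower semicontinuous functions *)

Section LowerSemicontinuous.
Variables (R : realType).

Lemma ereal_dense (x y : \bar R) : (x < y)%E -> (-oo < x)%E ->
  exists2 a : R, (x < a%:E)%E & (a%:E < y)%E.
Proof.
case: x => [x| |] // + _; last by rewrite ltNge leey.
case: y => [y| |] //.
  rewrite lte_fin => xy; exists ((x + y) / 2); rewrite lte_fin; lra.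
by move=> _; exists (x + 1); rewrite ?ltry // lte_fin; lra.
Qed.

(** The sublevel sets above the infimum generate a proper filter on the compact
    set; lower semicontinuity makes any cluster point of it a minimizer. *)
Lemma lower_semicontinuous_argmin (T : topologicalType) (K : set T)
    (g : T -> \bar R) : compact K -> K !=set0 -> lower_semicontinuous g ->
    (forall x, -oo < g x)%E ->
  exists2 p, K p & forall x, K x -> (g p <= g x)%E.
Proof.
move=> Kc [p0 Kp0] glsc gNy.
pose m := ereal_inf (g @` K).
have mle x : K x -> (m <= g x)%E by move=> Kx; apply: ereal_inf_lbound; exists x.
have [my|mNy] := eqVneq m +oo%E.
  exists p0 => // x Kx; apply: le_trans (mle x Kx); rewrite my; exact: leey.
have my : (m < +oo)%E by rewrite ltey.
pose F := filter_from [set a | (m < a)%E] (fun a => K `&` [set x | (g x <= a)%E]).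
have FF : ProperFilter F.
  apply: filter_from_proper.
    apply: filter_from_filter; first by exists +oo%E.
    move=> a b /= ma mb; exists (Order.min a b); first by rewrite /= lt_min ma.
    by move=> x /= [Kx]; rewrite le_min => /andP[? ?].
  move=> a /= /ereal_inf_lt[_ [x Kx <-] xa].
  by exists x; split => //=; exact: ltW.
have [p [Kp clp]] : K `&` cluster F !=set0.
  by apply: Kc; exists +oo%E.
exists p => // x Kx; apply: le_trans (mle x Kx).
rewrite leNgt; apply/negP => mp.
have [a ma ap] : exists2 a : R, (m < a%:E)%E & (a%:E < g p)%E.
  have [mN|mN] := eqVneq m -oo%E; last first.
    by apply: ereal_dense => //; rewrite ltNye.
  have := gNy p; case: (g p) mp => [r| |] // _ _.
    by exists (r - 1); rewrite ?mN ?ltNyr // lte_fin; lra.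
  by exists 0; rewrite ?mN ?ltNyr ?ltry.
have [V pV Va] := glsc _ _ ap.
have [y [[_ /= ya] Vy]] := clp (K `&` [set x | (g x <= a%:E)%E]) V
  ltac:(by exists a%:E) pV.
by have := Va y Vy; rewrite ltNge ya.
Qed.

Lemma lower_semicontinuousD (T : topologicalType) (g : T -> \bar R) (c : T -> R^o) :
  lower_semicontinuous g -> continuous c ->
  lower_semicontinuous (fun x => g x + (c x)%:E)%E.
Proof.
move=> glsc cc x a.
(* a real [r] strictly between [a - c x] and [g x] leaves room for [c] to vary *)
rewrite -lteBlDr // => agx.
have [r ar rg] := ereal_dense agx (ltNyr _).
rewrite -EFinB lte_fin in ar.
have [V xV Vg] := glsc _ _ rg.
exists (V `&` [set y | c x - (r - (a - c x)) < c y]).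
  apply: filterI => //; apply: (cc x [set b | c x - (r - (a - c x)) < b]).
  by apply: lt_nbhsr; lra.
move=> y [/Vg ry /= cy]; rewrite -lteBlDr //.
by apply: lt_trans ry; rewrite -EFinB lte_fin; lra.
Qed.

End LowerSemicontinuous.

(** * Proximal points and proximal subgradients *)

Section ProximalPoints.
Variables (R : realType) (n : nat).
Implicit Types (phi : 'cV[R]_n -> \bar R) (x y c v : 'cV[R]_n).

Lemma continuous_trmx m k : continuous (@trmx R m k).
Proof.
move=> x A /nbhs_ballP[e e0 eA]; apply/nbhs_ballP; exists e => // y [_ xy].
by apply: eA; split=> // i j; rewrite !mxE; exact: xy.
Qed.

(** Transposition is continuous, and for row vectors this is the compactness of a
    product of segments. *)
Lemma compact_box c (r : R) : compact [set y : 'cV[R]_n | forall i, `|y i 0 - c i 0| <= r].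
Proof.
pose box := [set w : 'rV[R]_n | forall i, `[c i 0 - r, c i 0 + r]%classic (w ord0 i)].
have -> : [set y : 'cV[R]_n | forall i, `|y i 0 - c i 0| <= r] = (@trmx R 1 n) @` box.
  apply/seteqP; split=> [y yr|_ [w wr <-] i] /=.
    exists y^T; last by rewrite trmxK.
    by move=> i /=; rewrite mxE in_itv /= -ler_distl.
  by rewrite mxE ler_distl; have := wr i; rewrite /= in_itv.
apply: continuous_compact; last first.
  apply: (@rV_compact R n (fun i => `[c i 0 - r, c i 0 + r]%classic)) => i.
  exact: segment_compact.
by apply: continuous_subspaceT; exact: continuous_trmx.
Qed.

Lemma coercive_argmin (g : 'cV[R]_n -> \bar R) c (a k : R) :
  lower_semicontinuous g -> (forall x, -oo < g x)%E ->
  0 < k -> (forall y, (a + k * dot (y - c) (y - c))%:E <= g y)%E ->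
  exists y, forall y', (g y <= g y')%E.
Proof.
move=> glsc gNy k0 gk.
have [gy|] := pselect (forall y, g y = +oo%E).
  by exists c => y'; rewrite !gy.
move=> /existsNP[y0 /eqP]; rewrite -ltey => gy0.
have [b gb] : exists b, g y0 = b%:E.
  by move: (gNy y0) gy0; case: (g y0) => // b; exists b.
(* outside the box of radius [r] around [c] the minorant exceeds [g y0] *)
pose r := 1 + `|b - a| / k.
have rb : b <= a + k * r ^+ 2.
  have r1 : 1 <= r by rewrite lerDl divr_ge0 // ltW.
  have : k * r <= k * r ^+ 2 by rewrite ler_pM2l // expr2 ler_peMr // (le_trans ler01).
  have -> : k * r = k + `|b - a| by rewrite /r mulrDr mulr1 mulrCA divff ?mulr1 ?gt_eqF.
  have := ler_norm (b - a); lra.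
have outside y : ~ (forall i, `|y i 0 - c i 0| <= r) -> (b%:E < g y)%E.
  move=> /existsNP[i /negP]; rewrite -ltNge => ri.
  apply: lt_le_trans (gk y); rewrite lte_fin (le_lt_trans rb) // ltrD2l ltr_pM2l //.
  apply: lt_le_trans (sqr_coord_le _ i); rewrite !mxE -[ltRHS]real_normK ?num_real //.
  have r0 : 0 <= r by rewrite addr_ge0 // divr_ge0 // ltW.
  by rewrite ltr_sqr ?nnegrE.
have Ky0 : forall i, `|y0 i 0 - c i 0| <= r.
  by apply: contrapT => /outside; rewrite gb ltxx.
have [p Kp pmin] := lower_semicontinuous_argmin (@compact_box c r)
  (ex_intro _ y0 Ky0) glsc gNy.
exists p => y'.
have [/pmin //|/outside by'] := pselect (forall i, `|y' i 0 - c i 0| <= r).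
by apply: le_trans (ltW by'); rewrite -gb pmin.
Qed.

Lemma continuous_sqr_dist (k : R) c :
  continuous (fun y : 'cV[R]_n => k * norm2 (c - y) ^+ 2 : R^o).
Proof.
have -> : (fun y => k * norm2 (c - y) ^+ 2 : R^o) =
    (fun y : 'cV[R]_n => k * \sum_(i < n) ((c i 0 - y i 0) * (c i 0 - y i 0)) : R^o).
  apply/funext => y; rewrite norm2_sq; congr (_ * _).
  by apply: eq_bigr => i _; rewrite !mxE.
have ci i : continuous (fun z : 'cV[R]_n => c i 0 - z i 0 : R^o).
  by move=> y; apply: (@continuousB R R^o) ; [exact: cst_continuous|exact: coord_continuous].
have sumc : continuous (fun y : 'cV[R]_n => \sum_(i < n) ((c i 0 - y i 0)*(c i 0 - y i 0)) : R^o).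
  apply: continuous_big => [|i _ y]; first exact: add_continuous.
  exact: cvgM (ci i y) (ci i y).
have kc : continuous (fun _ : 'cV[R]_n => k : R^o) by exact: cst_continuous.
move=> y; exact: cvgM (kc y) (sumc y).
Qed.

(** The quadratic minorant of [phi] has curvature [rho < lam^-1], so the proximal
    objective is coercive. The conclusion rewrites the minimality of [y] as a
    global quadratic minorant of [phi], with slope [lam^-1 (c - y)], that touches
    at [y]. *)
Lemma prox_point_exists phi x v c (p rho lam : R) :
  lower_semicontinuous phi -> (forall y, -oo < phi y)%E -> phi x = p%:E ->
  (forall y, (p + dot v (y - x) - rho / 2 * dot (y - x) (y - x))%:E <= phi y)%E ->
  0 < lam -> lam * rho < 1 ->
  exists y q, phi y = q%:E /\
    forall y', ((q + lam^-1 * dot (c - y) (y' - y)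
                  - (2 * lam)^-1 * dot (y' - y) (y' - y))%:E <= phi y')%E.
Proof.
move=> lsc phiNy phix minor lam0 lamrho.
(* half of the available curvature is kept, the rest absorbs the linear term *)
pose k := (lam^-1 - rho) / 4.
have k0 : 0 < k.
  rewrite divr_gt0 // subr_gt0 -[rho]mul1r -(mulVf (lt0r_neq0 lam0)) -mulrA.
  by rewrite gtr_pMr ?invr_gt0.
pose g := v - lam^-1 *: (c - x).
pose a := p - (4 * k)^-1 * dot g g + (2 * lam)^-1 * dot (c - x) (c - x).
have [||||y ymin] := @coercive_argmin (prox_objective lam phi c) x a k.
- apply: lower_semicontinuousD => //; exact: continuous_sqr_dist.
- move=> y; rewrite /prox_objective; have := phiNy y.
  by case: (phi y) => // r _; rewrite ltNyr.
- by [].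
- move=> y; rewrite /prox_objective norm2_sq.
  apply: le_trans (leeD2r _ (minor y)); rewrite -EFinD lee_fin.
  have -> : c - y = (c - x) - (y - x) by rewrite opprB addrA subrK.
  have : 0 <= k * dot ((2 * k)^-1 *: g + (y - x)) ((2 * k)^-1 *: g + (y - x)).
    by rewrite mulr_ge0 ?dot_ge0 ?ltW.
  have -> : dot v (y - x) = dot g (y - x) + lam^-1 * dot (c - x) (y - x).
    by rewrite -dotZl -dotDl subrK.
  rewrite /a {a}; move: (c - x) (y - x) g => w d g0; rewrite !dot_linear (dotC d).
  rewrite (dotC d w) (_ : (2 * lam)^-1 = (4 * k + rho) / 2); last first.
    by rewrite /k; field; rewrite gt_eqF.
  rewrite (_ : lam^-1 = 4 * k + rho); last by rewrite /k; field; rewrite gt_eqF.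
  rewrite -subr_ge0 => kN; rewrite -subr_ge0; move: kN; congr (0 <= _).
  by field; rewrite gt_eqF.
have [q phiy] : exists q, phi y = q%:E.
  have := ymin x; rewrite /prox_objective phix.
  by move: (phiNy y); case: (phi y) => // q; exists q.
exists y, q; split=> // y'; have := ymin y'.
rewrite /prox_objective phiy !norm2_sq.
have -> : c - y' = (c - y) - (y' - y) by rewrite opprB addrA subrK.
move: (c - y) (y' - y) => w d.
have := phiNy y'; case: (phi y') => [r| |] // _; last by move=> _; rewrite leey.
rewrite -!EFinD !lee_fin !dot_linear (dotC d w) => qr.
have -> : lam^-1 = 2 * (2 * lam)^-1 by field; rewrite gt_eqF.
lra.
Qed.

(** Constant sequences witness the limiting subgradient; the quadratic term is
    [o(|y' - y|)]. *)
Lemma quadratic_minorant_subdiff phi y v (q k : R) : phi y = q%:E ->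
  (forall y', (q + dot v (y' - y) - k * dot (y' - y) (y' - y))%:E <= phi y')%E ->
  limiting_subdiff phi y v.
Proof.
move=> phiy minor; split; first by rewrite phiy.
exists (fun=> y), (fun=> v); split; try exact: cvg_cst.
move=> _; split; first by rewrite phiy.
move=> e e0; apply/nbhs_norm2P; exists (e / (`|k| + 1)).
  by rewrite divr_gt0 // ltr_wpDl.
move=> y' yy'; apply: le_trans (minor y').
rewrite phiy -EFinD lee_fin -addrA lerD2l lerD2l lerN2 -norm2_sq expr2 mulrA.
apply: ler_wpM2r; first exact: norm2_ge0.
rewrite ltr_pdivlMr ?ltr_wpDl // in yy'.
have := ler_norm k; have := norm2_ge0 (y' - y); nra.
Qed.

End ProximalPoints.

(** * The midpoint inequality at a proximal point *)

Section Hypomonotonicity.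
Variables (R : realType) (n : nat).
Implicit Types (phi : 'cV[R]_n -> \bar R) (x y u v h z xb vb : 'cV[R]_n).

Definition mid x u := 2^-1 *: (x + u).

Lemma dot_mid_le x u (B : R) : dot x x <= B -> dot u u <= B ->
  dot (mid x u) (mid x u) <= B.
Proof.
move=> xB uB; have := dot_ge0 (x - u).
rewrite /mid !dot_linear (dotC u x); lra.
Qed.

Lemma dot_le_dist x y : dot x x <= 2 * dot y y + 2 * dot (x - y) (x - y).
Proof. have := dot_ge0 (2 *: y - x); rewrite !dot_linear (dotC y x); lra. Qed.

Lemma dot_diff_le x u (B : R) : dot x x <= B -> dot u u <= B ->
  dot (x - u) (x - u) <= 4 * B.
Proof. move=> xB uB; have := dot_ge0 (x + u); rewrite !dot_linear (dotC u x); lra. Qed.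

Lemma dot_le_avg x y : 2 * dot x y <= dot x x + dot y y.
Proof. have := dot_ge0 (x - y); rewrite !dot_linear (dotC y x); lra. Qed.

(** Averages, over [x] and [u], a quadratic minorant with subgradient
    [vb + t s (mid x u - h)] touching at [xb + t h]; dividing by [t^2 / 2] leaves
    the quotients [q], [a] and [b]. It is used twice: with [k = s] for the
    minorant that defines the proximal point, and with [k = rho] for the
    minorant that prox-regularity gives. *)
Lemma midpoint_test phi xb vb x u h (p0 q a b t s k : R) : 0 < t ->
  (phi (xb + t *: x)%R <= (p0 + t * dot vb x + t ^+ 2 / 2 * a)%:E)%E ->
  (phi (xb + t *: u)%R <= (p0 + t * dot vb u + t ^+ 2 / 2 * b)%:E)%E ->
  (forall y', ((p0 + t * dot vb h + t ^+ 2 / 2 * q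
      + dot (vb + (t * s) *: (mid x u - h)) (y' - (xb + t *: h))
      - k / 2 * dot (y' - (xb + t *: h)) (y' - (xb + t *: h)))%:E <= phi y')%E) ->
  q + (2 * s - k) * dot (h - mid x u) (h - mid x u)
    <= (a + b) / 2 + k / 4 * dot (x - u) (x - u).
Proof.
move=> t0 xa ub minor.
have test w c : (phi (xb + t *: w)%R <= (p0 + t * dot vb w + t ^+ 2 / 2 * c)%:E)%E ->
    q + 2 * s * dot (mid x u - h) (w - h) - k * dot (w - h) (w - h) <= c.
  move=> /(le_trans (minor _)); rewrite lee_fin.
  have -> : xb + t *: w - (xb + t *: h) = t *: (w - h).
    by rewrite scalerBr opprD addrACA subrr add0r.
  have -> : dot vb w = dot vb h + dot vb (w - h) by rewrite -dotDr addrC subrK.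
  move: (w - h) (mid x u - h) => d g; rewrite !dot_linear => le.
  rewrite -(ler_pM2l (_ : 0 < t ^+ 2 / 2)) ?divr_gt0 ?exprn_gt0 //; lra.
have := test _ _ xa; have := test _ _ ub.
rewrite /mid !dot_linear (dotC h x) (dotC h u) (dotC u x); lra.
Qed.

(** With step [t = lam^2], the proximal point of parameter [lam] near
    [mid x u] is [xb + t h]. The crude minorant of curvature [lam^-1] bounds [h]
    independently of [lam]; hence [xb + t h] and its subgradient
    [vb + lam (mid x u - h)] tend to [xb] and [vb], and prox-regularity applies.
    The minorant of curvature [rho] then beats the proximal term: this gives both
    the rate [K lam] and the bound on [q]. *)
Lemma midpoint_proximal_bound phi xb vb (p0 rho a b B : R) :
  lower_semicontinuous phi -> (forall y, -oo < phi y)%E -> phi xb = p0%:E ->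
  globally_prox_regular phi xb vb rho ->
  exists K lam0 : R, [/\ 0 < lam0, 0 <= K & forall (lam : R) x u, 0 < lam -> lam < lam0 ->
    dot x x <= B -> dot u u <= B ->
    (phi (xb + lam ^+ 2 *: x)%R
       <= (p0 + lam ^+ 2 * dot vb x + (lam ^+ 2) ^+ 2 / 2 * a)%:E)%E ->
    (phi (xb + lam ^+ 2 *: u)%R
       <= (p0 + lam ^+ 2 * dot vb u + (lam ^+ 2) ^+ 2 / 2 * b)%:E)%E ->
    exists h (q : R), [/\
      phi (xb + lam ^+ 2 *: h)%R
        = (p0 + lam ^+ 2 * dot vb h + (lam ^+ 2) ^+ 2 / 2 * q)%:E,
      dot (h - mid x u) (h - mid x u) <= K * lam &
      q <= (a + b) / 2 + rho / 4 * dot (x - u) (x - u)]].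
Proof.
move=> lsc phiNy phixb [vb_sub _ [e e0 pr]].
have minor y : ((p0 + dot vb (y - xb) - rho / 2 * dot (y - xb) (y - xb))%:E <= phi y)%E.
  have norm20 : norm2 (0 : 'cV[R]_n) = 0 by rewrite /norm2 dot0l sqrtr0.
  have := pr xb vb; rewrite !subrr norm20 => /(_ e0 e0 vb_sub).
  rewrite phixb -EFinD lte_fin ltrDl => /(_ e0 y).
  by rewrite -EFinD norm2_sq addrA.
(* [C] bounds [dot (h - z) (h - z)], [H] bounds [dot h h], [L] bounds the
   increase of [phi] divided by [lam]; [lam < W^-1] keeps the proximal point and its
   subgradient within the radius [e] of prox-regularity *)
pose r : R := `|rho|; pose m : R := (a + b) / 2.
pose C : R := 3 * `|B| + 2; pose H : R := 2 * `|B| + 2 * C.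
pose L : R := dot vb vb + H + `|m| + `|B|.
pose W : R := 1 + 4 * r + `|m| + (C + H) / e ^+ 2 + L / e.
have r0 : 0 <= r by exact: normr_ge0.
have B0 : 0 <= `|B| by exact: normr_ge0.
have m0 : 0 <= `|m| by exact: normr_ge0.
have C0 : 0 <= C by rewrite /C; lra.
have H0 : 0 <= H by rewrite /H; lra.
have L0 : 0 <= L by have := dot_ge0 vb; rewrite /L; lra.
have CH0 : 0 <= (C + H) / e ^+ 2 by apply: divr_ge0; [exact: addr_ge0|exact: sqr_ge0].
have Le0 : 0 <= L / e by rewrite divr_ge0 // ltW.
have [W1 W4r Wm WCH WL] : [/\ 1 <= W, 4 * r <= W, `|m| <= W,
    (C + H) / e ^+ 2 <= W & L / e <= W].
  rewrite /W; move: (_ / _) CH0 (L / e) Le0 => c c0 l l0.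
  by split; lra.
have W0 : 0 < W by exact: lt_le_trans W1.
exists (`|m| + r * (`|B| + H)), W^-1; split; rewrite ?invr_gt0 //.
  by rewrite addr_ge0 // mulr_ge0 // addr_ge0.
move=> lam x u lam0 lamW xB uB xa ub.
have {}lamW : lam * W < 1 by rewrite -ltr_pdivlMr // div1r.
have lam_le X : X <= W -> lam * X < 1.
  by move=> XW; apply: le_lt_trans lamW; rewrite ler_pM2l.
have lam1 : lam < 1 by rewrite -[lam]mulr1 lam_le.
have lamr : lam * r <= 4^-1 by have := lam_le _ W4r; lra.
have lamm : lam * `|m| <= 1 by rewrite ltW ?lam_le.
have lamCH : lam * (C + H) < e ^+ 2.
  by rewrite -[ltRHS]mul1r -ltr_pdivrMr ?exprn_gt0 // -mulrA lam_le.
have lamL : lam * L < e.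
  by rewrite -[ltRHS]mul1r -ltr_pdivrMr // -mulrA lam_le.
have rho_r : rho <= r by exact: ler_norm.
have rho_Nr : - r <= rho by rewrite /r lerNl -normrN ler_norm.
clearbody r.
pose t := lam ^+ 2.
have t0 : 0 < t by rewrite exprn_gt0.
pose z := mid x u.
have [|y [p [phiy prox_y]]] := @prox_point_exists R n phi xb vb
  (xb + lam *: vb + t *: z) p0 rho lam lsc phiNy phixb minor lam0.
  by apply: le_lt_trans (_ : lam * r < 1); [rewrite ler_pM2l | lra].
pose h := t^-1 *: (y - xb).
have yE : y = xb + t *: h by rewrite /h scalerA divff ?scale1r ?subrKC ?gt_eqF.
pose q := (p - p0 - t * dot vb h) / (t ^+ 2 / 2).
have pE : p = p0 + t * dot vb h + t ^+ 2 / 2 * q.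
  by rewrite /q mulrC; field; rewrite gt_eqF.
clearbody q h.
have vE : lam^-1 *: (xb + lam *: vb + t *: z - y) = vb + (t * lam^-1) *: (z - h).
  by rewrite yE; apply/colP => i; move: (z) => w; rewrite !mxE; field; rewrite gt_eqF.
pose D := dot (h - z) (h - z).
pose N := dot (x - u) (x - u).
have D0 : 0 <= D by exact: dot_ge0.
have test k : (forall y', ((p + dot (vb + (t * lam^-1) *: (z - h)) (y' - y)
      - k / 2 * dot (y' - y) (y' - y))%:E <= phi y')%E) ->
    q + (2 * lam^-1 - k) * D <= m + k / 4 * N.
  by rewrite pE yE; exact: midpoint_test.
have prox_minor y' : ((p + dot (vb + (t * lam^-1) *: (z - h)) (y' - y)
    - lam^-1 / 2 * dot (y' - y) (y' - y))%:E <= phi y')%E.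
  rewrite (_ : lam^-1 / 2 = (2 * lam)^-1); last by rewrite invfM mulrC.
  by have := prox_y y'; rewrite -dotZl vE.
have q_low : - (r * dot h h) <= q.
  have := minor y; rewrite phiy lee_fin pE yE (addrC xb) addrK !dot_linear.
  have := dot_ge0 h; move: (dot h h) => hh hh0.
  have t2 : 0 < t ^+ 2 / 2 by rewrite divr_gt0 ?exprn_gt0.
  move=> le; rewrite -(ler_pM2l t2); have := ler_wpM2r hh0 rho_r.
  move=> /(ler_wpM2l (ltW t2)); lra.
have z_le : dot z z <= `|B|.
  by apply: le_trans (ler_norm B); exact: dot_mid_le.
have N_le : N <= 4 * `|B|.
  by apply: le_trans (dot_diff_le xB uB) _; rewrite ler_pM2l // ler_norm.
have N0 : 0 <= N by exact: dot_ge0.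
have h_le : dot h h <= 2 * `|B| + 2 * D.
  by have := dot_le_dist h z; rewrite -/D; lra.
have m_le : m <= `|m| by exact: ler_norm.
(* the minorant of curvature [lam^-1], multiplied by [lam] *)
have coarse : lam * q + D <= lam * `|m| + `|B|.
  have := test _ prox_minor; rewrite -(ler_pM2l lam0).
  have -> : lam * (q + (2 * lam^-1 - lam^-1) * D) = lam * q + D by field; rewrite gt_eqF.
  have -> : lam * (m + lam^-1 / 4 * N) = lam * m + N / 4 by field; rewrite gt_eqF.
  have := ler_wpM2l (ltW lam0) m_le; lra.
have D_le : D <= C.
  have : lam * r * dot h h <= 4^-1 * (2 * `|B| + 2 * D).
    by apply: ler_pM; rewrite ?dot_ge0 ?mulr_ge0 // ltW.
  have := q_low; rewrite -(ler_pM2l lam0) /C; lra.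
have {}h_le : dot h h <= H by rewrite /H; lra.
have lam_sq : lam ^+ 2 <= lam by rewrite expr2 ger_pMr // ltW.
have y_near : norm2 (y - xb) < e.
  rewrite norm2_lt // yE (addrC xb) addrK !dot_linear mulrA.
  have tt_lam : t * t <= lam.
    by apply: (@le_trans _ _ t) => //; rewrite (ler_piMr (ltW t0)) // (le_trans lam_sq) // ltW.
  apply: le_lt_trans lamCH; apply: ler_pM => //.
  - exact: sqr_ge0.
  - exact: dot_ge0.
  - by rewrite (le_trans h_le) // lerDr.
have v_near : norm2 (vb + (t * lam^-1) *: (z - h) - vb) < e.
  have -> : t * lam^-1 = lam by rewrite /t expr2 mulfK ?gt_eqF.
  rewrite norm2_lt // addrAC subrr add0r -(opprB h z) dotZl dotZr dotNl dotNr opprK -/D mulrA.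
  apply: le_lt_trans lamCH; apply: ler_pM => //.
  - exact: sqr_ge0.
  - by rewrite (le_trans D_le) // lerDl.
have p_near : (phi y < phi xb + e%:E)%E.
  rewrite phiy phixb lte_fin pE -addrA ltrD2l; apply: le_lt_trans lamL.
  have t_lin : t * dot vb h <= lam * ((dot vb vb + H) / 2).
    apply: (@le_trans _ _ (t * ((dot vb vb + H) / 2))).
      by rewrite ler_pM2l //; have := dot_le_avg vb h; lra.
    by rewrite ler_wpM2r // divr_ge0 // addr_ge0 ?dot_ge0.
  have t_quad : t ^+ 2 / 2 * q <= lam * ((`|m| + `|B|) / 2).
    have -> : t ^+ 2 / 2 * q = lam ^+ 2 * lam * ((lam * q) / 2) by rewrite /t; field.
    apply: (@le_trans _ _ (lam ^+ 2 * lam * ((`|m| + `|B|) / 2))).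
      rewrite ler_pM2l ?mulr_gt0 ?exprn_gt0 //.
      have : lam * `|m| <= `|m| by rewrite ler_piMl // ltW.
      lra.
    rewrite ler_wpM2r ?divr_ge0 ?addr_ge0 // ger_pMl //.
    by rewrite expr_le1 ?ltW.
  rewrite /L; have := mulr_ge0 (ltW lam0) (addr_ge0 (addr_ge0 (addr_ge0 (dot_ge0 vb) H0) m0) B0).
  lra.
have v_sub : limiting_subdiff phi y (vb + (t * lam^-1) *: (z - h)).
  exact: quadratic_minorant_subdiff phiy prox_minor.
have reg y' : ((p + dot (vb + (t * lam^-1) *: (z - h)) (y' - y)
    - rho / 2 * dot (y' - y) (y' - y))%:E <= phi y')%E.
  by have := pr _ _ y_near v_near v_sub p_near y'; rewrite phiy -EFinD norm2_sq addrA.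
(* now the curvature [rho] replaces [lam^-1] *)
have fine := test _ reg.
have lamV : 4 * r <= lam^-1.
  by rewrite -[lam^-1]mul1r ler_pdivlMr //; lra.
exists h, q; split.
- by rewrite -/t -yE phiy pE.
- rewrite -/z -/D -ler_pdivrMr //.
  have rhoD : rho * D <= lam^-1 * D by rewrite ler_wpM2r //; lra.
  have rhoN : rho * N <= r * (4 * `|B|) by apply: le_trans (ler_wpM2l r0 N_le); rewrite ler_wpM2r.
  have := ler_wpM2l r0 h_le; lra.
- rewrite -/m -/N.
  have : 0 <= (2 * lam^-1 - rho) * D by rewrite mulr_ge0 //; lra.
  lra.
Qed.

End Hypomonotonicity.

(** * Second subderivatives along sequences *)

Section SecondSubderivative.
Variables (R : realType) (n : nat).
Implicit Types (phi : 'cV[R]_n -> \bar R) (x y u v h z xb vb : 'cV[R]_n).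

Lemma diff_quot2_lt phi xb vb h (p0 t a : R) : 0 < t -> phi xb = p0%:E ->
  (forall y, -oo < phi y)%E -> (diff_quot2 phi xb vb t h < a%:E)%E ->
  (phi (xb + t *: h)%R <= (p0 + t * dot vb h + t ^+ 2 / 2 * a)%:E)%E.
Proof.
move=> t0 phixb phiNy; rewrite /diff_quot2 phixb.
have t2 : 0 < (2^-1 * t ^+ 2)^-1 by rewrite invr_gt0 mulr_gt0 ?exprn_gt0.
have := phiNy (xb + t *: h); case: (phi _) => [s| |] // _; last first.
  by rewrite -EFinN /= mulyr gtr0_sg // mul1e.
rewrite -!EFinB -EFinM !lte_fin lee_fin ltr_pdivrMr ?mulr_gt0 ?exprn_gt0 //; lra.
Qed.

Lemma diff_quot2_eq phi xb vb h (p0 t q : R) : 0 < t -> phi xb = p0%:E ->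
  phi (xb + t *: h) = (p0 + t * dot vb h + t ^+ 2 / 2 * q)%:E ->
  diff_quot2 phi xb vb t h = q%:E.
Proof.
move=> t0 phixb phih; rewrite /diff_quot2 phixb phih -!EFinB -EFinM.
by congr EFin; field; rewrite gt_eqF.
Qed.

Lemma nbhs_right_norm2P z (P : set (R * 'cV[R]_n)) :
  filter_prod 0^'+ (nbhs z) P <-> exists2 r : R, 0 < r &
    forall t h, 0 < t -> t < r -> norm2 (h - z) < r -> P (t, h).
Proof.
split.
  case=> -[T H] /= [/nbhs_ballP[r1 /= r10 Tr]] /nbhs_norm2P[r2 r20 Hr] TH.
  exists (Num.min r1 r2); first by rewrite lt_min r10.
  move=> t h t0; rewrite !lt_min => /andP[tr1 _] /andP[_ hr2].
  apply: TH; split=> /=; last exact: Hr.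
  by apply: Tr => //; rewrite -ball_normE /= sub0r normrN gtr0_norm.
case=> r r0 rP; exists ([set t | 0 < t /\ t < r], [set h | norm2 (h - z) < r]).
  split=> /=; last by apply/nbhs_norm2P; exists r.
  apply/nbhs_ballP; exists r => // t /=.
  rewrite -ball_normE /= sub0r normrN => tr t0; split=> //.
  by rewrite (le_lt_trans (ler_norm _)).
by move=> [t h] /= [[t0 tr] hr]; exact: rP.
Qed.

Lemma second_subderivative_gt phi xb vb z (c : R) :
  (c%:E < second_subderivative phi xb vb z)%E ->
  exists2 r : R, 0 < r & forall t h, 0 < t -> t < r -> norm2 (h - z) < r ->
    (c%:E < diff_quot2 phi xb vb t h)%E.
Proof.
rewrite /second_subderivative limf_einfE => /ereal_sup_gt[_ [V zV <-] cV].
have [r r0 rV] := (nbhs_right_norm2P z V).1 zV.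
exists r => // t h t0 tr hr; apply: lt_le_trans cV _.
by apply: ereal_inf_lbound; exists (t, h) => //; exact: rV.
Qed.

Lemma second_subderivative_lt phi xb vb z (a : R) :
  (second_subderivative phi xb vb z < a%:E)%E ->
  forall r : R, 0 < r -> exists t h, [/\ 0 < t, t < r, norm2 (h - z) < r &
    (diff_quot2 phi xb vb t h < a%:E)%E].
Proof.
rewrite /second_subderivative limf_einfE => da r r0.
pose V := [set p : R * 'cV[R]_n | [/\ 0 < p.1, p.1 < r & norm2 (p.2 - z) < r]].
have zV : filter_prod 0^'+ (nbhs z) V.
  by apply/(nbhs_right_norm2P z); exists r.
have : (ereal_inf [set diff_quot2 phi xb vb p.1 p.2 | p in V] < a%:E)%E.
  by apply: le_lt_trans da; apply: ereal_sup_ubound; exists V.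
by move=> /ereal_inf_lt[_ [[t h] [/= t0 tr hr] <-] lta]; exists t, h.
Qed.

Lemma limn_einf_le (s : (\bar R)^nat) (a : \bar R) :
  (forall k, s k <= a)%E -> (limn_einf s <= a)%E.
Proof.
move=> sa; rewrite (_ : limn_einf s = limf_einf s \oo) // limf_einfE.
apply: ge_ereal_sup => _ [V [N _ NV] <-].
apply: le_trans (sa N); apply: ereal_inf_lbound; exists N => //.
by apply: NV => /=.
Qed.

Lemma limn_esup_lt (s : (\bar R)^nat) (a : \bar R) :
  (limn_esup s < a)%E -> \forall k \near \oo, (s k < a)%E.
Proof.
move=> /ereal_inf_lt[_ [V Voo <-] Va].
apply: filterS Voo => k Vk; apply: le_lt_trans Va.
by apply: ereal_sup_ubound; exists k.
Qed.

Lemma cvg_of_norm2 (s : ('cV[R]_n)^nat) x :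
  (forall k, norm2 (s k - x) < k.+1%:R^-1) -> s @ \oo --> x.
Proof.
move=> sx P /nbhs_norm2P[e e0 eP].
have := near_infty_natSinv_lt (PosNum e0); apply: filterS => k /= ke.
by apply: eP; exact: lt_trans ke.
Qed.

(** The epi-limit [g] does not exceed the second subderivative: along steps and
    points realizing the latter as a lower limit, [g x] is below the lower limit
    of the quotients. Since [g] is the same for all step sequences, its recovery
    sequence for the prescribed steps [t] is the required one. *)
Lemma epi_recovery phi xb vb x (a : R) (t : R^nat) :
  twice_epi_differentiable phi xb vb ->
  (second_subderivative phi xb vb x < a%:E)%E ->
  (forall k, 0 < t k) -> t @ \oo --> (0 : R) ->
  exists2 s : ('cV[R]_n)^nat, s @ \oo --> x &
    \forall k \near \oo, (diff_quot2 phi xb vb (t k) (s k) < a%:E)%E.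
Proof.
move=> [g epi] dxa t0 tcvg.
have ga : (g x < a%:E)%E.
  have [b dxb ba] : exists2 b : R, (second_subderivative phi xb vb x < b%:E)%E & b < a.
    move: dxa; case: (second_subderivative _ _ _ _) => [d| |] //.
      rewrite lte_fin => da; exists ((d + a) / 2); rewrite ?lte_fin; lra.
    by move=> _; exists (a - 1); rewrite ?ltNyr //; lra.
  have /choice[w wP] : forall k : nat, exists w : R * 'cV[R]_n,
      [/\ 0 < w.1, w.1 < k.+1%:R^-1, norm2 (w.2 - x) < k.+1%:R^-1 &
       (diff_quot2 phi xb vb w.1 w.2 < b%:E)%E].
    move=> k; have [|t' [h ?]] := second_subderivative_lt dxb (_ : 0 < k.+1%:R^-1).
      by rewrite invr_gt0 ltr0n.
    by exists (t', h).
  have w0 k : 0 < (w k).1 by case: (wP k).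
  have wcvg : (fun k => (w k).1) @ \oo --> (0 : R).
    apply/cvgrPdist_lt => e e0.
    have := near_infty_natSinv_lt (PosNum e0); apply: filterS => k /= ke.
    by rewrite sub0r normrN gtr0_norm //; apply: lt_trans ke; case: (wP k).
  have [lower _] := epi _ w0 wcvg x.
  apply: le_lt_trans (_ : b%:E < a%:E)%E; last by rewrite lte_fin.
  apply: le_trans (lower (fun k => (w k).2) _) _.
    by apply: cvg_of_norm2 => k; case: (wP k).
  by apply: limn_einf_le => k; apply: ltW; case: (wP k).
have [_ [s sx supg]] := epi _ t0 tcvg x.
by exists s => //; apply: limn_esup_lt; exact: le_lt_trans ga.
Qed.

End SecondSubderivative.

(** * Semiconvexity of the second subderivative *)

Section SemiconvexityOfSecondSubderivative.
Variables (R : realType) (n : nat).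
Implicit Types (phi : 'cV[R]_n -> \bar R) (x y u v h z xb vb : 'cV[R]_n).

(** Midpoint convexity of the second subderivative plus [rho |.|^2]. Were it to
    fail at [mid x u], the quotients near [mid x u] would exceed some [c] above
    the right-hand side, against the quotient at the proximal point built from
    recovery sequences at [x] and [u]. *)
Lemma second_subderivative_mid phi xb vb x u (rho a b : R) :
  lower_semicontinuous phi -> (forall y, -oo < phi y)%E ->
  globally_prox_regular phi xb vb rho ->
  twice_epi_differentiable phi xb vb ->
  (second_subderivative phi xb vb x <= a%:E)%E ->
  (second_subderivative phi xb vb u <= b%:E)%E ->
  (second_subderivative phi xb vb (mid x u)
    <= ((a + b) / 2 + rho / 4 * dot (x - u) (x - u))%:E)%E.
Proof.
move=> lsc phiNy pr epi dxa dub; rewrite leNgt; apply/negP => gap.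
have [p0 phixb] : exists p0, phi xb = p0%:E.
  by case: pr => -[/fineK <- _] _ _; exists (fine (phi xb)).
have [c] := ereal_dense gap (ltNyr _); rewrite lte_fin => gapc.
move=> /second_subderivative_gt[r r0 rc].
pose c0 : R := (a + b) / 2 + rho / 4 * dot (x - u) (x - u).
rewrite -/c0 in gapc.
(* replacing [a], [b] and [x - u] by their approximations costs [2 * d < c - c0] *)
pose d := (c - c0) / 3.
have d0 : 0 < d by rewrite divr_gt0 // subr_gt0.
pose lam (k : nat) : R := k.+1%:R^-1.
have lam0 k : 0 < lam k by rewrite invr_gt0 ltr0n.
have lam1 k : lam k <= 1 by rewrite invf_le1 ?ltr0n // ler1n.
have lamE e : 0 < e -> \forall k \near \oo, lam k < e.
  by move=> e0; exact: near_infty_natSinv_lt (PosNum e0).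
have t0 k : 0 < lam k ^+ 2 by rewrite exprn_gt0.
have t_lam k : lam k ^+ 2 <= lam k by rewrite expr2 (ler_piMr (ltW (lam0 k))).
have tcvg : (fun k => lam k ^+ 2) @ \oo --> (0 : R).
  apply/cvgrPdist_lt => e e0; apply: filterS (lamE e e0) => k ke.
  by rewrite sub0r normrN gtr0_norm // (le_lt_trans (t_lam k)).
have [s sx sa] : exists2 s : ('cV[R]_n)^nat, s @ \oo --> x &
    \forall k \near \oo, (diff_quot2 phi xb vb (lam k ^+ 2) (s k) < (a + d)%:E)%E.
  by apply: epi_recovery => //; apply: le_lt_trans dxa _; rewrite lte_fin ltrDl.
have [w wu wb] : exists2 w : ('cV[R]_n)^nat, w @ \oo --> u &
    \forall k \near \oo, (diff_quot2 phi xb vb (lam k ^+ 2) (w k) < (b + d)%:E)%E.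
  by apply: epi_recovery => //; apply: le_lt_trans dub _; rewrite lte_fin ltrDl.
pose B := 2 * dot x x + 2 * dot u u + 2.
have [K [l0 [l00 K0 bound]]] := midpoint_proximal_bound (a + d) (b + d) B
  lsc phiNy phixb pr.
have swcvg : (fun k => s k - w k) @ \oo --> x - u by exact: cvgB.
have dist_near : \forall k \near \oo,
    rho / 4 * dot (s k - w k) (s k - w k) < rho / 4 * dot (x - u) (x - u) + d.
  have : (fun k => rho / 4 * norm2 (0 - (s k - w k)) ^+ 2) @ \oo
      --> (rho / 4 * norm2 (0 - (x - u)) ^+ 2 : R^o).
    exact: (continuous_cvg _ (@continuous_sqr_dist _ n (rho / 4) 0 (x - u)) swcvg).
  move=> /cvgrPdist_lt /(_ d d0); apply: filterS => k /=.
  by rewrite !norm2_sq !sub0r !dotNl !dotNr !opprK distrC ltr_distl => /andP[].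
have r2 : 0 < r / 2 by rewrite divr_gt0.
have rK : 0 < (r / 2) ^+ 2 / (K + 1) by rewrite divr_gt0 ?exprn_gt0 ?ltr_wpDl.
near \oo => k.
have [sk1 wk1] : norm2 (s k - x) < 1 /\ norm2 (w k - u) < 1.
  by split; near: k; exact: cvg_norm2.
have [skr wkr] : norm2 (s k - x) < r / 2 /\ norm2 (w k - u) < r / 2.
  by split; near: k; exact: cvg_norm2.
have skB : dot (s k) (s k) <= B.
  have := dot_le_dist (s k) x; move: sk1; rewrite norm2_lt // expr1n /B.
  have := dot_ge0 u; lra.
have wkB : dot (w k) (w k) <= B.
  have := dot_le_dist (w k) u; move: wk1; rewrite norm2_lt // expr1n /B.
  have := dot_ge0 x; lra.
have [|||h [q [phih hz ql]]] := bound (lam k) (s k) (w k) (lam0 k) _ skB wkB.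
- by near: k; exact: lamE.
- by apply: diff_quot2_lt => //; near: k.
- by apply: diff_quot2_lt => //; near: k.
have hzr : norm2 (h - mid x u) < r.
  have hz' : dot (h - mid (s k) (w k)) (h - mid (s k) (w k)) < (r / 2) ^+ 2.
    apply: le_lt_trans hz _.
    have : lam k < (r / 2) ^+ 2 / (K + 1) by near: k; exact: lamE.
    by rewrite ltr_pdivlMr ?ltr_wpDl // mulrDr mulr1 mulrC; have := lam0 k; lra.
  have zz : dot (mid (s k) (w k) - mid x u) (mid (s k) (w k) - mid x u) < (r / 2) ^+ 2.
    have -> : mid (s k) (w k) - mid x u = mid (s k - x) (w k - u).
      by rewrite /mid -scalerBr opprD addrACA.
    rewrite norm2_lt // in skr; rewrite norm2_lt // in wkr.
    have := dot_ge0 ((s k - x) - (w k - u)); move: skr wkr.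
    move: (s k - x) (w k - u) => y v; rewrite /mid !dot_linear (dotC v y); lra.
  rewrite norm2_lt //.
  have := dot_le_dist (h - mid x u) (mid (s k) (w k) - mid x u).
  by rewrite opprB addrA subrK; move: hz' zz; lra.
have tr : lam k ^+ 2 < r.
  by apply: le_lt_trans (t_lam k) _; near: k; exact: lamE.
have := rc _ h (t0 k) tr hzr; rewrite (diff_quot2_eq (t0 k) phixb phih) lte_fin.
have : rho / 4 * dot (s k - w k) (s k - w k) < rho / 4 * dot (x - u) (x - u) + d.
  by near: k.
move: ql gapc; rewrite /d /c0; lra.
Unshelve. all: by end_near. Qed.

(** For a quadratic form the midpoint defect between [x] and [u] is a quarter of
    the form at [x - u], so midpoint convexity on the domain is a bound on its
    differences. *)
Lemma quadratic_hypomonotone phi xb vb (rho : R) (S : set 'cV[R]_n) (Q : 'M[R]_n) x u :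
  lower_semicontinuous phi -> (forall y, -oo < phi y)%E ->
  globally_prox_regular phi xb vb rho ->
  twice_epi_differentiable phi xb vb ->
  Q^T = Q -> (forall h, second_subderivative phi xb vb h
                = ((dot h (Q *m h))%:E + indicator S h)%E) ->
  S x -> S u -> S (mid x u) ->
  - (rho * dot (x - u) (x - u)) <= dot (x - u) (Q *m (x - u)).
Proof.
move=> lsc phiNy pr epi Qsym d2 Sx Su Sm.
have d2S h : S h -> second_subderivative phi xb vb h = (dot h (Q *m h))%:E.
  by move=> Sh; rewrite d2 /indicator asboolT // adde0.
have := @second_subderivative_mid _ _ _ x u _ (dot x (Q *m x)) (dot u (Q *m u))
  lsc phiNy pr epi.
rewrite !d2S // => /(_ (lexx _) (lexx _)); rewrite lee_fin.
have Qux : dot u (Q *m x) = dot x (Q *m u) by rewrite dot_mulmxr Qsym dotC.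
rewrite /mid -scalemxAr !(mulmxDr, mulmxN) !dot_linear Qux (dotC u x); lra.
Qed.

End SemiconvexityOfSecondSubderivative.

(** * Affine hulls of convex cones and orthogonal projections *)

Section AffineHullOfCone.
Variables (R : realType) (n : nat).
Implicit Types (S L : set 'cV[R]_n).

Lemma convex_mid S (x u : 'cV[R]_n) : convex_set S -> S x -> S u -> S (mid x u).
Proof.
move=> Sconv Sx Su.
have half01 : 0 <= (2^-1 : R) <= 1 by apply/andP; split; lra.
have := Sconv x u (Itv01 (andP half01).1 (andP half01).2) (mem_set Sx) (mem_set Su).
move=> /set_mem; congr S.
rewrite /conv /= /mid scalerDr; congr (_ + _); congr (_ *: _).
by rewrite /unstable.onem /=; lra.
Qed.

Lemma convex_coneD S x u : convex_set S -> cone S -> S x -> S u -> S (x + u).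
Proof.
move=> Sconv [_ Scone] Sx Su.
have -> : x + u = 2 *: mid x u by rewrite /mid scalerA divff ?scale1r.
by apply: Scone => //; exact: convex_mid.
Qed.

Lemma cone_scale_ge0 S (a : R) x : cone S -> 0 <= a -> S x -> S (a *: x).
Proof.
move=> [S0 Scone]; rewrite le_eqVlt => /orP[/eqP <-|a0 Sx]; first by rewrite scale0r.
exact: Scone.
Qed.

Lemma aff_convex_cone S h : convex_set S -> cone S ->
  aff S h <-> exists x u, [/\ S x, S u & h = x - u].
Proof.
move=> Sconv Scone; split.
  case=> m [c [p [Sp _ ->]]].
  have Ssum (a : 'I_m -> R) : (forall i, 0 <= a i) -> S (\sum_(i < m) a i *: p i).
    move=> a0; elim/big_ind: _ => [|x u|i _]; first by case: Scone.
      exact: convex_coneD.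
    exact: cone_scale_ge0.
  (* positive and negative parts of the coefficients *)
  exists (\sum_(i < m) Num.max (c i) 0 *: p i), (\sum_(i < m) Num.max (- c i) 0 *: p i).
  split; try by apply: Ssum => i; rewrite le_max lexx orbT.
  rewrite -sumrB; apply: eq_bigr => i _; rewrite -scalerBl; congr (_ *: _).
  by rewrite /Num.max; case: ltrP => c0; case: ltrP => c1; lra.
case=> x [u [Sx Su ->]].
(* the origin is a third point of [S] that brings the weights to sum 1 *)
exists 3%N, (fun i => [:: 1; -1; 1]`_i), (fun i => [:: x; u; 0]`_i); split.
- by case=> -[|[|[|//]]] //= _; case: Scone.
- by rewrite !big_ord_recl big_ord0 /=; lra.
- by rewrite !big_ord_recl big_ord0 /= scale1r scaleN1r scaler0 !addr0.
Qed.

Lemma aff_convex_cone_linear S : convex_set S -> cone S ->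
  aff S 0 /\ forall (a : R) h k, aff S h -> aff S k -> aff S (a *: h + k).
Proof.
move=> Sconv Scone; have affP h := aff_convex_cone h Sconv Scone.
split; first by apply/affP; exists 0, 0; rewrite subr0; case: Scone.
move=> a _ _ /affP[x [u [Sx Su ->]]] /affP[y [v [Sy Sv ->]]]; apply/affP.
have [a0|/ltW a0] := lerP 0 a.
  exists (a *: x + y), (a *: u + v); split; last by rewrite scalerBr opprD addrACA.
    by apply: convex_coneD => //; exact: cone_scale_ge0.
  by apply: convex_coneD => //; exact: cone_scale_ge0.
rewrite -oppr_ge0 in a0.
exists (- a *: u + y), (- a *: x + v); split.
- by apply: convex_coneD => //; exact: cone_scale_ge0.
- by apply: convex_coneD => //; exact: cone_scale_ge0.
- by apply/colP => i; rewrite !mxE; ring.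
Qed.

(** Among the matrices whose rows lie in [L], one of maximal rank spans [L]:
    otherwise adjoining a missing vector would increase the rank. *)
Lemma subspace_row_space L : L 0 ->
  (forall (a : R) h k, L h -> L k -> L (a *: h + k)) ->
  exists A : 'M[R]_n, forall v : 'rV[R]_n, (v <= A)%MS <-> L v^T.
Proof.
move=> L0 Llin.
pose inside (A : 'M[R]_n) := forall v : 'rV[R]_n, (v <= A)%MS -> L v^T.
pose P k := `[< exists A, inside A /\ \rank A = k >].
have exP : exists k, P k.
  exists 0%N; apply/asboolP; exists 0; split; last exact: mxrank0.
  by move=> v; rewrite submx0 => /eqP ->; rewrite trmx0.
have leP k : P k -> (k <= n)%N by move=> /asboolP[A [_ <-]]; exact: rank_leq_row.
case: (ex_maxnP exP leP) => k /asboolP[A [Ain Ak]] kmax.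
exists A => v; split; first exact: Ain.
move=> Lv; have Avin : inside (A + v)%MS.
  move=> w /sub_addsmxP[[a b] ->] /=.
  rewrite linearD /= addrC; have -> : b *m v = b 0 0 *: v.
    by rewrite [b]mx11_scalar mul_scalar_mx mxE eqxx mulr1n.
  by rewrite linearZ /=; apply: Llin => //; apply: Ain; exact: submxMl.
have := kmax (\rank (A + v)%MS); rewrite -Ak => /(_ _)/wrap[].
  by apply/asboolP; exists (A + v)%MS.
move=> le; apply: submx_trans (addsmxSr A v) _.
by rewrite -(mxrank_leqif_sup (addsmxSl A v)).2 eqn_leq le mxrankS ?addsmxSl.
Qed.

(** If the rows of [A] span [L], the row kernel of [A^T] is the orthogonal
    complement of [L]; it meets [L] trivially by positivity of [dot] and has the
    complementary dimension, so the projection along it exists. *)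
Lemma orthproj_exists L : L 0 ->
  (forall (a : R) h k, L h -> L k -> L (a *: h + k)) ->
  exists P, is_orthproj L P.
Proof.
move=> L0 Llin; have [A AP] := subspace_row_space L0 Llin.
pose N := kermx A^T.
have capAN : (A :&: N)%MS = 0.
  apply/eqP/rowV0P => v; rewrite sub_capmx => /andP[/submxP[w vE] /sub_kermxP vA0].
  have : dot v^T v^T = 0 by rewrite dotE trmxK {2}vE trmx_mul mulmxA vA0 mul0mx mxE.
  by move=> /dot_eq0 v0; rewrite -[v]trmxK v0 trmx0.
have full : row_full (A + N)%MS.
  rewrite /row_full mxrank_disjoint_sum // mxrank_ker mxrank_tr subnKC //.
  exact: rank_leq_row.
exists (proj_mx A N)^T => x.
pose r := x^T - x^T *m proj_mx A N.
have PxE : (proj_mx A N)^T *m x = (x^T *m proj_mx A N)^T by rewrite [RHS]trmx_mul trmxK.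
split; first by rewrite PxE; apply/AP; exact: proj_mx_sub.
move=> y Ly; have /AP/submxP[w yE] : L y^T^T by rewrite trmxK.
have /sub_kermxP rA0 : (r <= N)%MS by rewrite proj_mx_compl_sub // submx_full.
rewrite dotE PxE linearB /= trmxK -/r -[y]trmxK yE trmx_mul mulmxA rA0 mul0mx mxE //.
Qed.

Lemma orthprojP L : L 0 ->
  (forall (a : R) h k, L h -> L k -> L (a *: h + k)) -> is_orthproj L (orthproj L).
Proof.
move=> L0 Llin; apply: (@xgetPex _ 0 [set P | is_orthproj L P]).
exact: orthproj_exists.
Qed.

End AffineHullOfCone.

Lemma orthproj_sym (R : realType) (n : nat) (L : set 'cV[R]_n) (P : 'M[R]_n) x y :
  is_orthproj L P -> dot (P *m x) y = dot x (P *m y).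
Proof.
move=> projP; have dotP u v : dot u (P *m v) = dot (P *m u) (P *m v).
  apply/eqP; rewrite -subr_eq0 -dotNl -dotDl; apply/eqP.
  by have [_] := projP u; apply; case: (projP v).
by rewrite dotC [LHS]dotP [RHS]dotP dotC.
Qed.

Lemma orthproj_id (R : realType) (n : nat) (L : set 'cV[R]_n) (P : 'M[R]_n) h :
  is_orthproj L P -> (forall (a : R) h k, L h -> L k -> L (a *: h + k)) ->
  L h -> P *m h = h.
Proof.
move=> projP Llin Lh; have [LPh ortho] := projP h.
apply/esym/eqP; rewrite -subr_eq0; apply/eqP/dot_eq0/ortho.
by rewrite addrC -scaleN1r; exact: Llin.
Qed.

(** * Invertibility and conclusion *)

Lemma inj_unitmx (R : realType) (n : nat) (M : 'M[R]_n) :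
  (forall h : 'cV[R]_n, M *m h = 0 -> h = 0) -> M \in unitmx.
Proof.
move=> inj; rewrite -unitmx_tr -row_free_unit -kermx_eq0; apply/eqP/row_matrixP => i.
rewrite row0; apply: trmx_inj; rewrite trmx0; apply: inj.
by apply: trmx_inj; rewrite trmx_mul trmxK trmx0 -row_mul mulmx_ker row0.
Qed.

Theorem proposition2p4 (R : realType) (n : nat)
    (f : 'cV[R]_n -> R) (phi : 'cV[R]_n -> \bar R)
    (tau rho : R) (xb vb zb : 'cV[R]_n)
    (S : set 'cV[R]_n) (Q : 'M[R]_n)
    (f_C2 : twice_cont_differentiable f)
    (phi_proper : proper phi)
    (phi_lsc : lower_semicontinuous phi)
    (phi_pb : prox_bounded phi)
    (tau_gt0 : 0 < tau)
    (xb_stat : limiting_subdiff (fun x => ((f x)%:E + phi x)%E) xb 0)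
    (vbE : vb = - grad f xb)
    (zbE : zb = xb + tau *: vb)
    (phi_pr : globally_prox_regular phi xb vb rho)
    (tau_rho : tau * rho < 1)
    (phi_epi : twice_epi_differentiable phi xb vb)
    (S_closed : closed S) (S_convex : convex_set S) (S_cone : cone S)
    (Q_sym : Q^T = Q)
    (Q_range : range (fun h : 'cV[R]_n => Q *m h) `<=` aff S)
    (phi_d2 : forall h : 'cV[R]_n,
       second_subderivative phi xb vb h
         = ((dot h (Q *m h))%:E + indicator S h)%E)
    (proj_in : clarke_jacobian (prox tau phi) zb
       (orthproj (aff S) *m invmx (1%:M + tau *: Q) *m orthproj (aff S))) :
  (exists2 sigma : R, 0 < sigma &
     forall D : 'M[R]_n, clarke_jacobian (prox tau phi) zb D ->
       loewner_ge (D *m hess f xb *m D + tau^-1 *: (D *m (1%:M - D)))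
                  (sigma *: (D *m D))) ->
  exists2 sigma : R, 0 < sigma &
    forall h : 'cV[R]_n, aff S h ->
      sigma * norm2 h ^+ 2 <= dot h ((hess f xb + Q) *m h).
Proof.
move=> [sigma sigma0 growth]; exists sigma => // h Lh.
have [L0 Llin] := aff_convex_cone_linear S_convex S_cone.
have projP := orthprojP L0 Llin.
have {proj_in} := growth _ proj_in.
move: (orthproj _) projP => P projP {growth}.
set M := 1%:M + tau *: Q.
have ME k : M *m k = tau *: (Q *m k) + k by rewrite mulmxDl mul1mx -scalemxAl addrC.
have LQ k : aff S (Q *m k) by apply: Q_range; exists k.
have M_unit : M \in unitmx.
  apply: inj_unitmx => k; rewrite ME => Mk0.
  have Lk : aff S k.
    have -> : k = (- tau) *: (Q *m k) + 0.
      by rewrite addr0 scaleNr; apply/eqP; rewrite -addr_eq0 addrC Mk0.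
    exact: Llin.
  have /aff_convex_cone[//|//|x [u [Sx Su kE]]] := Lk.
  have := quadratic_hypomonotone phi_lsc phi_proper.1 phi_pr phi_epi Q_sym phi_d2
    Sx Su (convex_mid S_convex Sx Su).
  rewrite -kE => hypo.
  have kMk : tau * dot k (Q *m k) + dot k k = 0 by rewrite -dotZr -dotDr Mk0 dotC dot0l.
  apply: dot_eq0; apply/eqP; rewrite eq_le dot_ge0 andbT.
  rewrite -(pmulr_rle0 _ (_ : 0 < 1 - tau * rho)) ?subr_gt0 //.
  by have := ler_wpM2l (ltW tau_gt0) hypo; lra.
have MsymV u v : dot u (invmx M *m v) = dot (invmx M *m u) v.
  by rewrite dot_mulmxr trmx_inv /M linearD /= linearZ /= trmx1 Q_sym.
pose D := P *m invmx M *m P; rewrite -/D.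
have Dsym u v : dot u (D *m v) = dot (D *m u) v.
  by rewrite /D -!mulmxA -(orthproj_sym _ _ projP) MsymV -(orthproj_sym _ _ projP) !mulmxA.
(* on [L] the matrix [D] inverts [M] *)
have DM : D *m (M *m h) = h.
  rewrite /D -!mulmxA (orthproj_id projP Llin (h := M *m h)).
    by rewrite mulKmx // (orthproj_id projP).
  by rewrite ME; exact: Llin.
clearbody D.
have Du x : dot (M *m h) (D *m x) = dot h x by rewrite Dsym DM.
move=> /(_ (M *m h)).
have -> : (D *m hess f xb *m D + tau^-1 *: (D *m (1%:M - D)) - sigma *: (D *m D)) *m (M *m h)
    = D *m (hess f xb *m h) + tau^-1 *: (D *m (tau *: (Q *m h))) - sigma *: (D *m h).
  rewrite mulmxBl mulmxDl -!scalemxAl -!mulmxA DM mulmxBl mul1mx DM.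
  by rewrite [in M *m h]ME addrK.
rewrite dotDr dotNr dotDr !dotZr !Du dotZr mulKf ?gt_eqF //.
by rewrite norm2_sq mulmxDl dotDr subr_ge0.
Qed.
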